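(* There exists an absolute constant $C$ such that for all sufficiently large $n$, every properly edge-coloured graph on $n$ vertices with at least $Cn(\log n)^4$ edges contains a rainbow cycle of even length.
   Context: An edge-colouring is proper if any two edges sharing a vertex receive different colours; a subgraph is rainbow if all its edges have distinct colours. Logarithms are base $2$. *)

(* Defs.v *)
From Stdlib Require Import Reals.
From mathcomp Require Import all_boot.
Set Implicit Arguments. Unset Strict Implicit. Unset Printing Implicit Defensive.

Definition simple_graph (n : nat) (adj : rel 'I_n) : Prop :=
  symmetric adj /\ irreflexive adj.

Definition edges (n : nat) (adj : rel 'I_n) : {set {set 'I_n}} :=
  [set e : {set 'I_n} | [exists x, exists y, adj x y && (e == [set x; y])]].

(* An edge-colouring assigns a colour (a natural number) to each unordered
   pair; only its values on edges matter.  It is proper if two distinct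
   edges sharing a vertex get different colours. *)
Definition proper_colouring (n : nat) (adj : rel 'I_n) (c : {set 'I_n} -> nat)
  : Prop :=
  forall x y z : 'I_n, adj x y -> adj x z -> y != z ->
    c [set x; y] != c [set x; z].

Definition is_cycle (n : nat) (adj : rel 'I_n) (s : seq 'I_n) : Prop :=
  [/\ 3 <= size s, uniq s & cycle adj s].

Definition cycle_colours (n : nat) (c : {set 'I_n} -> nat) (s : seq 'I_n)
  : seq nat :=
  match s with
  | [::] => [::]
  | x :: _ => [seq c [set (nth x s i); (nth x s ((i.+1) %% size s))]
               | i <- iota 0 (size s)]
  end.

Definition rainbow_cycle (n : nat) (adj : rel 'I_n) (c : {set 'I_n} -> nat)
  (s : seq 'I_n) : Prop :=
  is_cycle adj s /\ uniq (cycle_colours c s).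

Definition log2 (x : R) : R := Rdiv (ln x) (ln (INR 2)).

(* Main.v *)
Require Import Defs.
From Stdlib Require Import Reals Classical.
From mathcomp Require Import all_boot all_order all_algebra.
From mathcomp Require Import Rstruct ring lra zify.
Import Order.TTheory GRing.Theory Num.Theory.
Set Implicit Arguments. Unset Strict Implicit. Unset Printing Implicit Defensive.

Local Open Scope ring_scope.

(** Pass to a bipartite subgraph of minimum degree [d] of order [(log n)^2] and
    let [W = D^(-1/2) A D^(-1/2)], so that [\tr (W ^+ 2k)] is a weighted count
    of closed walks of length [2k]; it is at least [1] because [W] has the
    eigenvalue [1].  Let [M_c] be the part of [W] supported on colour [c].  Closed
    walks that repeat a colour at two prescribed places have total weight
    [\sum_c \tr (M_c W^s M_c W^t)] with [s + t = 2k - 2].  This is a symmetric,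
    convex function of [s], hence at most its value at [s = 0], which
    is at most [\tr (W ^+ (2k - 2)) / d] since [\sum_c M_c^2] is diagonal with
    entries at most [1 / d].  As [\tr (W ^+ 0) = n], some [k = O(log n)] has
    [\tr (W ^+ (2k - 2)) <= 2 * \tr (W ^+ 2k)], and for this [k] the walks with
    a repeated colour cannot account for all closed walks of length [2k].  A
    shortest rainbow closed walk is a cycle, even by bipartiteness. *)

(** * Traces of powers of a symmetric matrix *)

Lemma mxtrace_mul_tr_ge0 (F : realFieldType) (m n : nat) (A : 'M[F]_(m, n)) :
  0 <= \tr (A *m A^T).
Proof.
rewrite /mxtrace; apply: sumr_ge0 => i _; rewrite mxE.
by apply: sumr_ge0 => j _; rewrite mxE -expr2 sqr_ge0.
Qed.

Lemma trmx_expr (F : realFieldType) (n : nat) (W : 'M[F]_n) (k : nat) :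
  W^T = W -> (W ^+ k)^T = W ^+ k.
Proof.
move=> sW; elim: k => [|k IH]; first by rewrite !expr0 trmx1.
by rewrite exprS -mulmxE trmx_mul sW IH mulmxE -exprSr exprS.
Qed.

Lemma mxtrace_even_expr_ge0 (F : realFieldType) (n : nat) (W : 'M[F]_n)
    (k : nat) :
  W^T = W -> 0 <= \tr (W ^+ k.*2).
Proof.
move=> sW; have := mxtrace_mul_tr_ge0 (W ^+ k).
by rewrite trmx_expr // mulmxE -exprD addnn.
Qed.

Lemma expr_even_diag_ge0 (F : realFieldType) (n : nat) (W : 'M[F]_n)
    (k : nat) (x : 'I_n) :
  W^T = W -> 0 <= (W ^+ k.*2) x x.
Proof.
move=> sW; rewrite -addnn exprD -{2}(trmx_expr k sW) -mulmxE mxE.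
by apply: sumr_ge0 => j _; rewrite mxE -expr2 sqr_ge0.
Qed.

(** Let [B] be the orthogonal projection onto the line of [v]. It has trace 1 and absorbs [W ^+ k]
    on both sides, so expanding [0 <= \tr ((W ^+ k - B) *m (W ^+ k - B)^T)] leaves
    [\tr (W ^+ k.*2) - 1]. *)
Lemma mxtrace_expr_even_ge1 (F : realFieldType) (n : nat) (W : 'M[F]_n)
    (v : 'cV[F]_n) (k : nat) :
  W^T = W -> W *m v = v -> v != 0 -> 1 <= \tr (W ^+ k.*2).
Proof.
move=> sW Wv v0.
pose q := (v^T *m v) 0 0.
have q_gt0 : 0 < q.
  rewrite /q mxE lt0r; apply/andP; split; last first.
    by apply: sumr_ge0 => j _; rewrite mxE -expr2 sqr_ge0.
  apply: contra v0 => /eqP s0; apply/eqP/colP => i; rewrite mxE.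
  have /psumr_eq0P : forall j : 'I_n, true -> 0 <= v^T 0 j * v j 0.
    by move=> j _; rewrite mxE -expr2 sqr_ge0.
  move=> /(_ s0 i isT)/eqP; rewrite mxE -expr2 sqrf_eq0 => /eqP->.
  by [].
have vv : v^T *m v = q%:M by rewrite [LHS]mx11_scalar.
pose B := q^-1 *: (v *m v^T).
have Wkv : W ^+ k *m v = v.
  elim: k => [|k IH]; first by rewrite expr0 mul1mx.
  by rewrite exprSr -mulmxE -mulmxA Wv.
have sB : B^T = B by rewrite /B linearZ /= trmx_mul trmxK.
have WB : W ^+ k *m B = B by rewrite /B -scalemxAr mulmxA Wkv.
have BW : B *m W ^+ k = B.
  by apply: trmx_inj; rewrite trmx_mul trmx_expr // sB WB.
have BB : B *m B = B.
  rewrite /B -scalemxAr -scalemxAl mulmxA -(mulmxA v) vv.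
  by rewrite mul_mx_scalar -scalemxAl [X in _ *: X]scalerA mulVf ?gt_eqF // scale1r.
have tB : \tr B = 1.
  by rewrite /B linearZ /= mxtrace_mulC vv mxtrace_scalar mulr1n mulVf ?gt_eqF.
have := mxtrace_mul_tr_ge0 (W ^+ k - B).
rewrite linearB /= trmx_expr // sB mulmxBl !mulmxBr WB BW BB subrr subr0.
by rewrite mulmxE -exprD addnn linearB /= tB subr_ge0.
Qed.

(** * Traces with two inserted factors, and convexity *)

Lemma mxtrace_two_insert_sym (F : realFieldType) (n : nat) (W M : 'M[F]_n)
    (s t : nat) :
  \tr (M *m W ^+ s *m (M *m W ^+ t)) = \tr (M *m W ^+ t *m (M *m W ^+ s)).
Proof. exact: mxtrace_mulC. Qed.

(* Expand [0 <= \tr ((X - Y) *m (X - Y)^T)] for [X = W^a M W^b] and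
   [Y = W^a' M W^b']. *)
Lemma mxtrace_two_insert_convex (F : realFieldType) (n : nat) (W M : 'M[F]_n)
    (a b a' b' : nat) :
  W^T = W -> M^T = M ->
  \tr (M *m W ^+ (a + a') *m (M *m W ^+ (b + b'))) *+ 2 <=
  \tr (M *m W ^+ a.*2 *m (M *m W ^+ b.*2)) +
  \tr (M *m W ^+ a'.*2 *m (M *m W ^+ b'.*2)).
Proof.
move=> sW sM.
have tE i j i' j' :
    \tr (W ^+ i *m M *m W ^+ j *m (W ^+ i' *m M *m W ^+ j')^T) =
    \tr (M *m W ^+ (i + i') *m (M *m W ^+ (j + j'))).
  rewrite !trmx_mul !trmx_expr // sM mxtrace_two_insert_sym (addnC i) !exprD.
  by rewrite -!mulmxE -!mulmxA mxtrace_mulC -!mulmxA.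
have := mxtrace_mul_tr_ge0 (W ^+ a *m M *m W ^+ b - W ^+ a' *m M *m W ^+ b').
rewrite linearB /= mulmxBl !mulmxBr !linearB /= !tE !addnn (addnC a') (addnC b').
rewrite mulr2n; set p := \tr _; set q := \tr _; set r := \tr _.
lra.
Qed.

(** Once [g] exceeds [g 0] its last increment was nonnegative ([up]), and convexity keeps the later
    ones nonnegative. So [g] stays above [g 0] up to [K], against [g K = g 0]. *)
Lemma convex_le_endpoint (F : realFieldType) (g : nat -> F) (K : nat) :
  (forall a, (a.+1 < K)%N -> g a.+1 *+ 2 <= g a + g a.+2) ->
  g K = g 0%N -> forall a, (a <= K)%N -> g a <= g 0%N.
Proof.
move=> cvx gK.
have up a : (a < K)%N -> g 0%N < g a.+1 -> g a <= g a.+1.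
  elim: a => [|a IH] aK; first exact: ltW.
  case: (lerP (g a.+1) (g 0%N)) => [le0 /ltW|gt0 _]; first exact: le_trans.
  have := cvx _ aK; have := IH (ltnW aK) gt0; rewrite mulr2n; lra.
move=> a aK; rewrite leNgt; apply/negP => ga.
suff /(_ (K - a)%N) : forall d, (a + d <= K)%N -> g 0%N < g (a + d)%N.
  by rewrite subnKC // gK ltxx => /(_ (leqnn K)).
elim=> [|d IH] dK; first by rewrite addn0.
rewrite addnS in dK *; have {IH} IH := IH (ltnW dK).
apply: (lt_le_trans IH).
case E: (a + d)%N IH dK => [|e] IH dK; first by rewrite ltxx in IH.
have := cvx _ dK; have := up _ (ltnW dK) IH; rewrite mulr2n; lra.
Qed.

(* In steps of two the trace is convex in [s], and it is symmetric under
   [s <-> t]; odd [s] are dominated by their even neighbours. *)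
Lemma mxtrace_two_insert_le (F : realFieldType) (n : nat) (W M : 'M[F]_n)
    (K s t : nat) :
  W^T = W -> M^T = M -> (s + t = K.*2)%N ->
  \tr (M *m W ^+ s *m (M *m W ^+ t)) <= \tr (M *m M *m W ^+ K.*2).
Proof.
move=> sW sM stK.
pose g a := \tr (M *m W ^+ a.*2 *m (M *m W ^+ (K - a).*2)).
have g0 : g 0%N = \tr (M *m M *m W ^+ K.*2).
  by rewrite /g double0 subn0 expr0 mulmx1 mulmxA.
have gK : g K = g 0%N.
  by rewrite /g subnn subn0 mxtrace_two_insert_sym.
have cvx a : (a.+1 < K)%N -> g a.+1 *+ 2 <= g a + g a.+2.
  move=> aK; have := mxtrace_two_insert_convex a (K - a) a.+2 (K - a.+2) sW sM.
  rewrite (_ : a + a.+2 = a.+1.*2)%N; last lia.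
  by rewrite (_ : K - a + (K - a.+2) = (K - a.+1).*2)%N; last lia.
have gle := convex_le_endpoint cvx gK; rewrite -g0.
have [sE|sO] := boolP (odd s); last first.
  have -> : s = (s./2).*2 by lia.
  have -> : t = ((K - s./2).*2)%N by lia.
  by apply: gle; lia.
have := mxtrace_two_insert_convex s./2 (K - s./2) (s./2).+1 (K - (s./2).+1) sW sM.
rewrite (_ : s./2 + (s./2).+1 = s)%N; last lia.
rewrite (_ : K - s./2 + (K - (s./2).+1) = t)%N; last lia.
have : g s./2 <= g 0%N by apply: gle; lia.
have : g (s./2).+1 <= g 0%N by apply: gle; lia.
rewrite /g mulr2n; lra.
Qed.

(** * Traces of products as sums over closed walks *)

Lemma big_tuple_cons (R : Type) (idx : R) (op : Monoid.com_law idx)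
    (T : finType) (m : nat) (G : m.+1.-tuple T -> R) :
  \big[op/idx]_(p : m.+1.-tuple T) G p =
  \big[op/idx]_(x : T) \big[op/idx]_(p : m.-tuple T) G [tuple of x :: p].
Proof.
rewrite pair_bigA /= (reindex (fun q : T * m.-tuple T => [tuple of q.1 :: q.2])) //.
exists (fun t => (thead t, [tuple of behead t])) => [[x p] _|t _] /=.
  by rewrite theadE; congr (_, _); apply: val_inj.
by rewrite -tuple_eta.
Qed.

(** The tuple [p] lists the vertices of a walk after its start [x]. The factors depend on the
    position so that a colour matrix can replace [W] at chosen steps. *)
Lemma prod_mx_entry (F : comPzRingType) (n m : nat) (N : nat -> 'M[F]_n)
    (x y : 'I_n) :
  (\prod_(0 <= i < m) N i) x y =
  \sum_(p : m.-tuple 'I_n) (last x p == y)%:R *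
    \prod_(0 <= i < m) N i (nth x (x :: p) i) (nth x p i).
Proof.
elim: m N x => [|m IH] N x.
  rewrite big_nil (big_pred1 [tuple]) => [|p]; last by symmetry; apply/eqP; exact: tuple0.
  by rewrite big_nil mulr1 mxE.
rewrite big_nat_recl // big_tuple_cons -mulmxE mxE; apply: eq_bigr => z _.
rewrite IH big_distrr; apply: eq_bigr => p _ /=.
rewrite big_nat_recl //= mulrCA; congr (_ * (_ * _)).
(* The induction hypothesis reads the tail with default [z]; all indices are in range, so the
   default can be changed to [x]. *)
apply: eq_big_nat => i /andP[_ im]; congr (N _ _ _).
  by apply: set_nth_default; rewrite /= size_tuple ltnS ltnW.
by apply: set_nth_default; rewrite size_tuple.
Qed.

Lemma mxtrace_prod (F : comPzRingType) (n m : nat) (N : nat -> 'M[F]_n) :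
  \tr (\prod_(0 <= i < m) N i) =
  \sum_x \sum_(p : m.-tuple 'I_n) (last x p == x)%:R *
    \prod_(0 <= i < m) N i (nth x (x :: p) i) (nth x p i).
Proof. by apply: eq_bigr => x _; rewrite prod_mx_entry. Qed.

(** By cyclicity of the trace, the [i] factors before the first [M] move to the end and join the
    [m - j.+1] factors after the second. *)
Lemma mxtrace_prod_two_insert (F : comPzRingType) (n m i j : nat) (W M : 'M[F]_n) :
  (i < j < m)%N ->
  \tr (\prod_(0 <= h < m) (if (h == i) || (h == j) then M else W)) =
  \tr (M *m W ^+ (j - i.+1) *m (M *m W ^+ (m - j.+1 + i))).
Proof.
move=> /andP[ij jm].
rewrite (@big_cat_nat _ _ _ i) ?leq0n //=; last by rewrite ltnW // (ltn_trans ij).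
rewrite (big_ltn (m := i)) ?(ltn_trans ij) // eqxx /=.
rewrite (@big_cat_nat _ _ _ j i.+1 m) //=; last exact: ltnW.
rewrite (big_ltn (m := j)) // eqxx orbT.
have cst a b : (forall h, (a <= h < b)%N -> (h != i) && (h != j)) ->
    \prod_(a <= h < b) (if (h == i) || (h == j) then M else W) = W ^+ (b - a).
  move=> H; rewrite -prodr_const_nat; apply: eq_big_nat => h /H.
  by rewrite -negb_or => /negbTE->.
rewrite !cst => [||h|h]; try lia.
rewrite subn0 -!mulmxE mxtrace_mulC -!mulmxA exprD.
by rewrite -mulmxE.
Qed.

(** * Weight of the closed walks that repeat a colour *)

Definition colour_mx (F : pzRingType) (n : nat) (col : 'I_n -> 'I_n -> nat)
    (W : 'M[F]_n) (k : nat) : 'M[F]_n :=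
  \matrix_(x, y) (W x y *+ (col x y == k)).

Lemma colour_mx_tr (F : pzRingType) (n : nat) (col : 'I_n -> 'I_n -> nat)
    (W : 'M[F]_n) (k : nat) :
  (forall x y, col x y = col y x) -> W^T = W ->
  (colour_mx col W k)^T = colour_mx col W k.
Proof.
move=> sc sW; apply/matrixP => x y; rewrite !mxE sc.
by rewrite -[in LHS]sW mxE.
Qed.

(** A union bound: each closed walk of nonzero weight has equal colours at some steps [i < j], so
    its weight occurs in the term of [i], [j] and that colour. All other terms are nonnegative. *)
Lemma mxtrace_le_repeats (F : realFieldType) (n m K : nat) (W : 'M[F]_n)
    (r : rel 'I_n) (col : 'I_n -> 'I_n -> nat) :
  (forall x y, 0 <= W x y) -> (forall x y, W x y != 0 -> r x y) ->
  (forall x y, col x y < K)%N ->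
  (forall x p, size p = m -> path r x p -> last x p = x ->
     ~~ uniq (pairmap col x p)) ->
  \tr (W ^+ m) <=
  \sum_(i < m) \sum_(j < m | (i < j)%N) \sum_(k < K)
    \tr (\prod_(0 <= h < m)
       (if (h == i) || (h == j) then colour_mx col W k else W)).
Proof.
move=> W0 Wr colK rep.
pose N (i j k : nat) h := if (h == i) || (h == j) then colour_mx col W k else W.
have N0 i j k h x y : 0 <= N i j k h x y.
  by rewrite /N; case: ifP => // _; rewrite mxE mulrn_wge0.
have -> : W ^+ m = \prod_(0 <= h < m) W by rewrite prodr_const_nat subn0.
under [leRHS]eq_bigr do under eq_bigr do under eq_bigr do rewrite mxtrace_prod.
rewrite mxtrace_prod.
(* Bring the sums over the start [x] and the tuple [p] outermost on the right, so that the
   inequality can be checked walk by walk. *)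
under [leRHS]eq_bigr do under eq_bigr do rewrite exchange_big /=.
under [leRHS]eq_bigr do rewrite exchange_big /=.
rewrite [leRHS]exchange_big /=; apply: ler_sum => x _.
under [leRHS]eq_bigr do under eq_bigr do rewrite exchange_big /=.
under [leRHS]eq_bigr do rewrite exchange_big /=.
rewrite [leRHS]exchange_big /=; apply: ler_sum => p _.
have T0 (i j k : nat) :
    0 <= (last x p == x)%:R *
      \prod_(0 <= h < m) N i j k h (nth x (x :: p) h) (nth x p h).
  by rewrite mulr_ge0 ?ler0n // prodr_ge0.
have [lx|_] := eqVneq (last x p) x; last first.
  rewrite mul0r; do 3 (apply: sumr_ge0 => ? _); rewrite mul0r //.
rewrite mul1r.
set w := \prod_(_ <= _ < _) _.
have [w0|wN0] := eqVneq w 0.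
  rewrite w0; do 3 (apply: sumr_ge0 => ? _).
  by rewrite mul1r prodr_ge0 // => h _; apply: N0.
have pr : path r x p.
  apply/(pathP x) => h; rewrite size_tuple => hm; apply: Wr.
  apply: contra wN0 => /eqP Wh; rewrite /w big_mkord.
  by apply/prodf_eq0; exists (Ordinal hm) => //=; rewrite Wh.
have := rep x p (size_tuple p) pr lx.
move=> /(uniqPn 0%N)[i [j [ij]]]; rewrite size_pairmap size_tuple => jm.
have im := ltn_trans ij jm.
rewrite !(nth_pairmap x) ?size_tuple // => cij.
set k := col _ _ in cij.
have kK : (k < K)%N by apply: colK.
have lx1 : (last x p == x)%:R = 1 :> F by rewrite lx eqxx.
rewrite (bigD1 (Ordinal im)) //= (bigD1 (Ordinal jm)) //=.
rewrite (bigD1 (Ordinal kK)) //= -!addrA.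
(* Steps [i] and [j] have colour [k], so restricting them to that colour leaves the weight of the
   walk unchanged. *)
have -> : w = 1 * \prod_(0 <= h < m)
    N (Ordinal im) (Ordinal jm) (Ordinal kK) h (nth x (x :: p) h) (nth x p h).
  rewrite mul1r; apply: eq_big_nat => h /andP[_ hm]; rewrite /N /=.
  case: ifP => // /orP[] /eqP->; rewrite mxE.
    by rewrite -/k eqxx.
  by rewrite -cij eqxx.
rewrite lerDl; rewrite lx1 in T0; rewrite !addr_ge0 //.
- by apply: sumr_ge0 => a _; apply: T0.
- by do 2 (apply: sumr_ge0 => ? _); apply: T0.
- by do 3 (apply: sumr_ge0 => ? _); apply: T0.
Qed.

(** An off-diagonal entry of the square of a colour matrix would need two edges of one colour at a
    common vertex. The diagonal entries, summed over the colours, give the row sums of [W x y ^+ 2];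
    they are weighted by the diagonal of an even power, which is nonnegative. *)
Lemma mxtrace_colour_sqr_le (F : realFieldType) (n K t : nat) (W : 'M[F]_n)
    (col : 'I_n -> 'I_n -> nat) (eps : F) :
  W^T = W -> (forall x y, col x y = col y x) ->
  (forall x y, col x y < K)%N ->
  (forall x y z, W x y != 0 -> W x z != 0 -> y != z -> col x y != col x z) ->
  (forall x, \sum_y W x y ^+ 2 <= eps) ->
  \sum_(k < K) \tr (colour_mx col W k *m colour_mx col W k *m W ^+ t.*2) <=
  eps * \tr (W ^+ t.*2).
Proof.
move=> sW sc colK prop_c Weps.
have WC x y : W x y = W y x by rewrite -[in LHS]sW mxE.
have offdiag (k : nat) x z : x != z ->
    (colour_mx col W k *m colour_mx col W k) x z = 0.
  move=> xz; rewrite mxE big1 // => y _; rewrite !mxE.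
  have [ck|_] := eqVneq (col x y) k; last by rewrite mul0r.
  have [ck'|_] := eqVneq (col y z) k; last by rewrite mulr0.
  have [Wx|Wx] := eqVneq (W x y) 0; first by rewrite Wx mul0r.
  have [Wz|Wz] := eqVneq (W y z) 0; first by rewrite Wz mulr0.
  by rewrite WC in Wx; have := prop_c y x z Wx Wz xz; rewrite sc ck ck' eqxx.
have trE (k : nat) : \tr (colour_mx col W k *m colour_mx col W k *m W ^+ t.*2) =
    \sum_x (\sum_y (W x y ^+ 2 *+ (col x y == k))) * (W ^+ t.*2) x x.
  apply: eq_bigr => x _; rewrite mxE (bigD1 x) //= [X in _ + X]big1 ?addr0.
    rewrite mxE; congr (_ * _); apply: eq_bigr => y _; rewrite !mxE sc (WC y).
    by case: (_ == k); rewrite ?mulr0 // !mulr1n.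
  by move=> z zx; rewrite offdiag 1?eq_sym // mul0r.
under eq_bigr do rewrite trE.
rewrite exchange_big mulr_sumr; apply: ler_sum => x _ /=.
rewrite -mulr_suml ler_wpM2r ?expr_even_diag_ge0 //.
apply: le_trans (Weps x); rewrite exchange_big /=; apply: ler_sum => y _.
rewrite (bigD1 (Ordinal (colK x y))) //= eqxx mulr1n big1 ?addr0 // => k.
by rewrite -val_eqE /= eq_sym => /negbTE->.
Qed.

Lemma mxtrace_expr_le_of_repeats (F : realFieldType) (n k : nat) (W : 'M[F]_n)
    (r : rel 'I_n) (col : 'I_n -> 'I_n -> nat) (eps : F) :
  (forall x y, 0 <= W x y) -> W^T = W ->
  (forall x y, W x y != 0 -> r x y) ->
  (forall x y, col x y = col y x) ->
  (forall x y z, r x y -> r x z -> y != z -> col x y != col x z) ->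
  (forall x, \sum_y W x y ^+ 2 <= eps) -> 0 <= eps ->
  (forall x p, size p = k.+1.*2 -> path r x p -> last x p = x ->
     ~~ uniq (pairmap col x p)) ->
  \tr (W ^+ k.+1.*2) <= (k.+1.*2 ^ 2)%:R * (eps * \tr (W ^+ k.*2)).
Proof.
move=> W0 sW Wr sc prop_c Weps eps0 rep.
(* [K] exceeds every colour in use, which makes the sum over colours finite. *)
pose K := (\max_(q : 'I_n * 'I_n) col q.1 q.2).+1.
have colK x y : (col x y < K)%N.
  by rewrite ltnS (leq_bigmax (F := fun q : 'I_n * 'I_n => col q.1 q.2) (x, y)).
have T0 : 0 <= eps * \tr (W ^+ k.*2) by rewrite mulr_ge0 ?mxtrace_even_expr_ge0.
apply: le_trans (mxtrace_le_repeats W0 Wr colK rep) _.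
(* The pairs [i < j] are bounded by all pairs of positions. *)
have -> : (k.+1.*2 ^ 2)%:R * (eps * \tr (W ^+ k.*2)) =
    \sum_(i < k.+1.*2) \sum_(j < k.+1.*2) eps * \tr (W ^+ k.*2).
  by rewrite !sumr_const card_ord -mulrnA mulr_natl mulnn.
apply: ler_sum => i _; rewrite big_mkcond /=; apply: ler_sum => j _.
case: ifP => // ij.
have prop_W x y z : W x y != 0 -> W x z != 0 -> y != z -> col x y != col x z.
  by move=> /Wr xy /Wr xz; apply: prop_c.
apply: le_trans (mxtrace_colour_sqr_le k sW sc colK prop_W Weps).
apply: ler_sum => c _; rewrite mxtrace_prod_two_insert ?ij ?ltn_ord //.
apply: mxtrace_two_insert_le => //; first exact: colour_mx_tr.
by have := ltn_ord j; lia.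
Qed.

(** * Choice of the walk length *)

(** If [a] more than halved at each of the [L] steps, then [a 0] would be at least
    [2 ^+ L * a L]. *)
Lemma ex_small_ratio (F : realFieldType) (a : nat -> F) (L : nat) :
  a 0%N < 2 ^+ L * a L -> exists2 k, (k < L)%N & a k <= 2 * a k.+1.
Proof.
elim: L => [|L IH]; first by rewrite expr0 mul1r ltxx.
case: (lerP (a L) (2 * a L.+1)) => [le _|lt]; first by exists L.
rewrite exprSr -mulrA => lt0.
case: IH => [|k kL ak]; last by exists k => //; apply: ltnW.
by apply: lt_trans lt0 _; rewrite ltr_pM2l ?exprn_gt0.
Qed.

(** The traces start at [n < 2 ^ L] and never drop below 1, so some [k < L] has ratio at most 2. For
    it, the bound on walks with a repeated colour can be divided by the positive trace [b]. *)
Lemma no_rainbow_closed_walk_bound (F : realFieldType) (n L : nat)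
    (W : 'M[F]_n) (v : 'cV[F]_n) (r : rel 'I_n)
    (col : 'I_n -> 'I_n -> nat) (eps : F) :
  (forall x y, 0 <= W x y) -> W^T = W -> W *m v = v -> v != 0 ->
  (forall x y, W x y != 0 -> r x y) ->
  (forall x y, col x y = col y x) ->
  (forall x y z, r x y -> r x z -> y != z -> col x y != col x z) ->
  (forall x, \sum_y W x y ^+ 2 <= eps) -> 0 <= eps ->
  (n < 2 ^ L)%N ->
  (forall x p, p != [::] -> path r x p -> last x p = x ->
     ~~ uniq (pairmap col x p)) ->
  1 <= (8 * L ^ 2)%:R * eps.
Proof.
move=> W0 sW Wv v0 Wr sc prop_c Weps eps0 nL rep.
have a_ge1 k : 1 <= \tr (W ^+ k.*2) by apply: mxtrace_expr_even_ge1 Wv v0.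
have : \tr (W ^+ 0.*2) < 2 ^+ L * \tr (W ^+ L.*2).
  rewrite double0 expr0 mxtrace1; apply: (@lt_le_trans _ _ (2 ^+ L)).
    by rewrite -natrX ltr_nat.
  by rewrite ler_peMr ?exprn_ge0.
move=> /(@ex_small_ratio _ (fun k => \tr (W ^+ k.*2)))[k kL /= ak].
have rep_k x p : size p = k.+1.*2 -> path r x p -> last x p = x ->
    ~~ uniq (pairmap col x p).
  by move=> sp; apply: rep; rewrite -size_eq0 sp.
have := mxtrace_expr_le_of_repeats W0 sW Wr sc prop_c Weps eps0 rep_k.
have := a_ge1 k.+1; set b := \tr (W ^+ k.+1.*2) in ak *.
move=> b1 le_b; have b_gt0 : 0 < b by apply: lt_le_trans b1.
rewrite -(ler_pM2r b_gt0) mul1r; apply: (le_trans le_b).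
apply: (@le_trans _ _ ((k.+1.*2 ^ 2)%:R * (eps * (2 * b)))).
  by rewrite ler_wpM2l // ler_wpM2l.
rewrite (_ : _ * (eps * (2 * b)) = (k.+1.*2 ^ 2)%:R * 2 * (eps * b)); last ring.
rewrite -[leRHS]mulrA; apply: ler_wpM2r; first by rewrite mulr_ge0 ?(ltW b_gt0).
rewrite -(natrM _ _ 2) ler_nat.
(* Since [k < L], twice the square of [2 * k.+1] is at most [8 * L ^ 2]. *)
rewrite -mul2n expnMn; have : (k.+1 ^ 2 <= L ^ 2)%N by rewrite leq_sqr.
lia.
Qed.

(** * Degrees and the normalised adjacency matrix *)

Definition degree (T : finType) (r : rel T) (x : T) : nat := \sum_y r x y.

(** For a symmetric irreflexive relation this is twice the number of edges. *)
Definition degree_sum (T : finType) (r : rel T) : nat := \sum_x degree r x.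

(** The normalised adjacency matrix fixes the vector of square roots of degrees, and its rows have
    square sum at most [1 / d]. The degree bound concerns only vertices with a neighbour, so a
    subgraph can be kept on the vertex set ['I_n] with the other vertices isolated. *)
Lemma min_degree_le_no_rainbow (n L d : nat) (r : rel 'I_n)
    (col : 'I_n -> 'I_n -> nat) :
  symmetric r -> (exists x y, r x y) ->
  (forall x y, r x y -> (d <= degree r x)%N) -> (n < 2 ^ L)%N ->
  (forall x y, col x y = col y x) ->
  (forall x y z, r x y -> r x z -> y != z -> col x y != col x z) ->
  (forall x p, p != [::] -> path r x p -> last x p = x ->
     ~~ uniq (pairmap col x p)) ->
  (d <= 8 * L ^ 2)%N.
Proof.
move=> sr [x0 [y0 r0]] dmin nL sc prop_c rep.
have [->//|d_gt0] := posnP d.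
pose s (x : 'I_n) : R := Num.sqrt (degree r x)%:R.
have s2 x : s x ^+ 2 = (degree r x)%:R by rewrite sqr_sqrtr.
have s0 x y : r x y -> s x != 0.
  move=> /dmin dx; rewrite sqrtr_eq0 -ltNge ltr0n; exact: leq_trans dx.
pose W : 'M[R]_n := \matrix_(x, y) ((r x y)%:R / (s x * s y)).
pose v : 'cV[R]_n := \col_x s x.
have W0 x y : 0 <= W x y.
  by rewrite mxE divr_ge0 ?ler0n // mulr_ge0 ?sqrtr_ge0.
have sW : W^T = W by apply/matrixP => x y; rewrite !mxE sr (mulrC (s y)).
have Wr x y : W x y != 0 -> r x y.
  by rewrite mxE; case: (r x y) => //; rewrite mul0r eqxx.
have Wv : W *m v = v.
  apply/colP => x; rewrite !mxE.
  have -> : \sum_y W x y * v y 0 = \sum_y (r x y)%:R / s x.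
    apply: eq_bigr => y _; rewrite !mxE; case E: (r x y); last by rewrite !mul0r.
    by rewrite invfM mulrA divfK // (s0 y x) // sr.
  rewrite -mulr_suml -natr_sum -/(degree r x) -s2.
  by have [->|sx] := eqVneq (s x) 0; rewrite ?expr0n ?mul0r // expr2 mulfK.
have v0 : v != 0.
  apply/eqP => /colP/(_ x0); rewrite !mxE => /eqP; apply/negP; exact: s0 _ _ r0.
have Weps x : \sum_y W x y ^+ 2 <= d%:R^-1.
  (* The row of an isolated vertex vanishes, with the convention that the inverse of 0 is 0. *)
  have [dx|dx] := posnP (degree r x).
    rewrite big1 ?invr_ge0 ?ler0n // => y _; rewrite mxE /s dx sqrtr0 mul0r.
    by rewrite invr0 mulr0 expr0n.
  apply: (@le_trans _ _ (\sum_y (r x y)%:R * ((degree r x)%:R^-1 * d%:R^-1))).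
    apply: ler_sum => y _; rewrite mxE; case E: (r x y); last first.
      by rewrite !mul0r expr0n.
    rewrite !mul1r exprVn exprMn !s2 invfM ler_wpM2l ?invr_ge0 ?ler0n //.
    have dy : (d <= degree r y)%N by apply: (dmin y x); rewrite sr.
    by rewrite lef_pV2 ?posrE ?ltr0n ?ler_nat // (leq_trans d_gt0).
  by rewrite -mulr_suml -natr_sum mulVKf // pnatr_eq0 -lt0n.
have eps0 : 0 <= d%:R^-1 :> R by rewrite invr_ge0 ler0n.
have := no_rainbow_closed_walk_bound W0 sW Wv v0 Wr sc prop_c Weps eps0 nL rep.
by rewrite ler_pdivlMr ?ltr0n // mul1r ler_nat.
Qed.

(** * Subgraphs of large minimum degree and bipartite subgraphs *)

(** Both extremal arguments below alter a graph only at one vertex [v]; each edge at [v] is counted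
    once in its row and once in its column. *)
Lemma degree_sum_change_at (T : finType) (r r' : rel T) (v : T) :
  symmetric r -> symmetric r' -> ~~ r v v -> ~~ r' v v ->
  (forall x y, x != v -> y != v -> r x y = r' x y) ->
  (degree_sum r + (degree r' v).*2 = degree_sum r' + (degree r v).*2)%N.
Proof.
have splitE (q : rel T) : symmetric q -> ~~ q v v ->
    degree_sum q =
    ((degree q v).*2 + \sum_(x | x != v) \sum_(y | y != v) q x y)%N.
  move=> sq /negbTE qv; rewrite /degree_sum (bigD1 v) //= -addnn -addnA.
  congr (_ + _)%N.
  have -> : degree q v = (\sum_(x | x != v) q x v)%N.
    by rewrite /degree (bigD1 v) //= qv; apply: eq_bigr => x _; rewrite sq.
  by rewrite -big_split; apply: eq_bigr => x _; rewrite /degree (bigD1 v).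
move=> sr sr' rv rv' rr'; rewrite !splitE //.
have -> : (\sum_(x | x != v) \sum_(y | y != v) r x y =
    \sum_(x | x != v) \sum_(y | y != v) r' x y)%N.
  by apply: eq_bigr => x xv; apply: eq_bigr => y yv; rewrite rr'.
lia.
Qed.

(** Choose [U] to maximise [f], which rewards each deleted vertex by [2 * d]. Deleting a vertex of
    degree below [d] would lose less than that. The density hypothesis says that [f] is larger at
    [setT] than at [set0], so [U] is nonempty. *)
Lemma ex_min_degree_subgraph (T : finType) (r : rel T) (d : nat) :
  symmetric r -> irreflexive r -> (d.*2 * #|T| < degree_sum r)%N ->
  exists2 U : {set T}, U != set0 &
    forall x, x \in U ->
      (d <= degree [rel a b | [&& r a b, a \in U & b \in U]] x)%N.
Proof.
move=> sr ir big.
pose rU (U : {set T}) := [rel a b | [&& r a b, a \in U & b \in U]].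
pose f U := (degree_sum (rU U) + d.*2 * #|~: U|)%N.
case: (@arg_maxnP _ setT predT f isT) => U _ maxU.
exists U => [|v vU].
  apply/eqP => U0; have := maxU setT isT; rewrite /f U0 setCT cards0 muln0 addn0.
  have -> : degree_sum (rU set0) = 0%N.
    by apply: big1 => x _; apply: big1 => y _; rewrite /= !inE !andbF.
  have -> : degree_sum (rU setT) = degree_sum r.
    by apply: eq_bigr => x _; apply: eq_bigr => y _; rewrite /= !inE !andbT.
  rewrite setC0 cardsT add0n; lia.
have := maxU (U :\ v) isT; rewrite /f.
have -> : (#|~: (U :\ v)| = #|~: U|.+1)%N.
  have := cardsC U; have := cardsC (U :\ v); rewrite (cardsD1 v U) vU; lia.
have sU A : symmetric (rU A).
  by move=> a b; rewrite /= sr [(a \in A) && _]andbC.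
have d0 : degree (rU (U :\ v)) v = 0%N.
  by apply: big1 => y _; rewrite /= !inE eqxx andbF.
have : (degree_sum (rU U) + (degree (rU (U :\ v)) v).*2 =
        degree_sum (rU (U :\ v)) + (degree (rU U) v).*2)%N.
  apply: degree_sum_change_at => //=; rewrite ?ir //.
  by move=> x y xv yv; rewrite !inE xv yv.
rewrite d0 mulnS /rU; lia.
Qed.

(** Take a maximum cut [S]. Moving [v] to the other side exchanges the cut and uncut edges at [v],
    so at least half of them are cut. *)
Lemma ex_bipartite_half_degree (T : finType) (r : rel T) :
  symmetric r -> irreflexive r ->
  exists S : {set T}, forall x,
    (degree r x <=
     (degree [rel a b | r a b && ((a \in S) != (b \in S))] x).*2)%N.
Proof.
move=> sr ir.
pose rS (S : {set T}) := [rel a b | r a b && ((a \in S) != (b \in S))].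
case: (@arg_maxnP _ set0 predT (fun S => degree_sum (rS S)) isT) => S _ maxS.
exists S => v.
pose S' := [set x | (x \in S) (+) (x == v)].
have sS A : symmetric (rS A) by move=> a b; rewrite /= sr eq_sym.
have : (degree_sum (rS S) + (degree (rS S') v).*2 =
        degree_sum (rS S') + (degree (rS S) v).*2)%N.
  apply: degree_sum_change_at => //=; rewrite ?ir //.
  by move=> x y /negbTE xv /negbTE yv; rewrite !inE xv yv !addbF.
have : degree r v = (degree (rS S) v + degree (rS S') v)%N.
  rewrite /degree -big_split; apply: eq_bigr => y _ /=; rewrite !inE eqxx.
  have [->|yv] := eqVneq y v; first by rewrite ir.
  by case: (r v y) (v \in S) (y \in S) => [] [] [].
have := maxS S' isT; rewrite /rS /=; lia.
Qed.

(** Adjacent ordered pairs map onto the edges; the factor 2 given away here only affects the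
    constant. *)
Lemma degree_sum_ge_edges (n : nat) (adj : rel 'I_n) :
  (#|edges adj| <= degree_sum adj)%N.
Proof.
have -> : degree_sum adj = #|[set q : 'I_n * 'I_n | adj q.1 q.2]|.
  rewrite /degree_sum /degree pair_big /= -sum1_card [RHS]big_mkcond /=.
  by apply: eq_bigr => q _; rewrite inE; case: (adj _ _).
apply: leq_trans (leq_imset_card (fun q : 'I_n * 'I_n => [set q.1; q.2]) _).
apply: subset_leq_card; apply/subsetP => e; rewrite inE.
case/existsP => x /existsP[y /andP[axy /eqP->]].
by apply/imsetP; exists (x, y); rewrite ?inE.
Qed.

(** * From rainbow closed walks to even cycles *)

Lemma path_alternate (T : eqType) (r : rel T) (side : T -> bool) (x : T)
    (p : seq T) :
  (forall a b, r a b -> side a != side b) -> path r x p ->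
  side (last x p) = side x (+) odd (size p).
Proof.
move=> alt; elim: p x => [|y p IH] x /=; first by rewrite addbF.
case/andP => /alt xy /IH->; move: xy.
by case: (side x) (side y) (odd _) => [] [] [].
Qed.

(* A shortest such closed walk repeats no vertex, and alternation makes its
   length even. *)
Lemma rainbow_closed_walk_cycle (n : nat) (adj r : rel 'I_n)
    (c : {set 'I_n} -> nat) (side : 'I_n -> bool) :
  (forall a b, r a b -> adj a b) -> (forall a b, r a b -> side a != side b) ->
  forall x p, p != [::] -> path r x p -> last x p = x ->
  uniq (pairmap (fun a b => c [set a; b]) x p) ->
  exists s : seq 'I_n, rainbow_cycle adj c s /\ ~~ odd (size s).
Proof.
move=> sub alt x p; have [m] := ubnP (size p); elim: m x p => // m IH x p pm.
move=> p0 pr lx up.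
have [u|/(uniqPn x)[i [j [ij jp eq_ij]]]] := boolP (uniq p).
  case: (lastP p) p0 pr lx up u {pm} => // q z _ pr.
  rewrite last_rcons => zx; subst z => up.
  rewrite rcons_uniq -cons_uniq => uq.
  have ev : odd (size q).+1 = false.
    have := path_alternate alt pr; rewrite last_rcons size_rcons.
    by case: (side x) (odd _) => [] [].
  exists (x :: q); split; last exact: negbT ev.
  split; last first.
    (* The two colour lists agree index by index; at the last index [size q] the modulus wraps
       around to the start [x]. *)
    suff <- : pairmap (fun a b => c [set a; b]) x (rcons q x) =
              cycle_colours c (x :: q) by [].
    apply: (@eq_from_nth _ 0%N); rewrite size_pairmap size_rcons.
      by rewrite size_map size_iota.
    move=> k kq; rewrite (nth_pairmap x) ?size_rcons //.
    rewrite (nth_map 0%N) ?size_iota // nth_iota // add0n.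
    rewrite -rcons_cons !nth_rcons /= kq; congr (c [set _; _]).
    case: (ltngtP k (size q)) => kk.
    - by rewrite modn_small.
    - by rewrite ltnS leqNgt kk in kq.
    - by rewrite kk modnn.
  split=> //; last first.
    by apply: sub_path pr.
  (* Length 1 is excluded by parity, and length 2 because the walk would use one edge twice and
     repeat its colour. *)
  case: q ev pr up {uq} => [|y [|z q]] //= _ _.
  by rewrite setUC inE eqxx.
(* The segment of the walk between two visits to [y] is a shorter closed walk, whose colours form a
   block of the original colour list. *)
pose y := nth x p i.
have ip := ltn_trans ij jp.
pose q := take (j - i) (drop i.+1 p).
have sq : size q = (j - i)%N.
  by rewrite size_takel // size_drop; lia.
have pE : p = take i p ++ y :: q ++ drop (j - i) (drop i.+1 p).
  by rewrite cat_take_drop -drop_nth // cat_take_drop.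
apply: (IH y q).
- by rewrite sq; lia.
- by rewrite -size_eq0 sq; lia.
- by move: pr; rewrite pE cat_path /= cat_path => /and3P[_ _ /andP[]].
- rewrite (last_nth x) sq; have -> : (j - i = (j - i.+1).+1)%N by lia.
  rewrite /= nth_take; last by lia.
  by rewrite nth_drop (_ : i.+1 + _ = j)%N; last lia.
- move: up; rewrite {1}pE pairmap_cat /= pairmap_cat cat_uniq.
  by case/and3P => _ _ /= /andP[_]; rewrite cat_uniq => /and3P[].
Qed.

(** * From the number of edges to the theorem *)

(** The edge count yields a subgraph of minimum degree [16 * L ^ 2 + 2]. Its bipartite half has
    degrees at least [8 * L ^ 2 + 1] on [U], just above the bound that holds when there is no
    rainbow closed walk. *)
Lemma ex_rainbow_even_cycle_of_edges (n L : nat) (adj : rel 'I_n)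
    (c : {set 'I_n} -> nat) :
  simple_graph adj -> proper_colouring adj c -> (n < 2 ^ L)%N ->
  ((16 * L ^ 2).+2.*2 * n < #|edges adj|)%N ->
  exists s : seq 'I_n, rainbow_cycle adj c s /\ ~~ odd (size s).
Proof.
move=> [sa ia] prop_c nL big; apply: NNPP => no_cycle.
have {big} big : ((16 * L ^ 2).+2.*2 * #|'I_n| < degree_sum adj)%N.
  by rewrite card_ord (leq_trans big) ?degree_sum_ge_edges.
have [U /set0Pn[x0 x0U] minU] := ex_min_degree_subgraph sa ia big.
set r0 := (r in degree r) in minU.
have sr0 : symmetric r0.
  by move=> a b; rewrite /r0 /= sa [(a \in U) && _]andbC.
have ir0 : irreflexive r0 by move=> a; rewrite /r0 /= ia.
have [S halfS] := ex_bipartite_half_degree sr0 ir0.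
pose r := [rel a b | r0 a b && ((a \in S) != (b \in S))].
have {}halfS x : (degree r0 x <= (degree r x).*2)%N := halfS x.
have r_adj a b : r a b -> adj a b by move=> /andP[/and3P[]].
have r_alt a b : r a b -> (a \in S) != (b \in S) by move=> /andP[].
have deg_r x : x \in U -> (8 * L ^ 2 < degree r x)%N.
  by move=> /minU; have := halfS x; lia.
suff : ((8 * L ^ 2).+1 <= 8 * L ^ 2)%N by rewrite ltnn.
apply: (@min_degree_le_no_rainbow n L _ r (fun a b => c [set a; b])) => //.
- by move=> a b; rewrite /r /= sr0 eq_sym.
- have := leq_ltn_trans (leq0n _) (deg_r x0 x0U).
  rewrite lt0n sum_nat_eq0 negb_forall => /existsP[y].
  by rewrite eqb0 negbK => ry; exists x0, y.
- by move=> x y /andP[/and3P[_ xU _] _]; apply: deg_r.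
- by move=> x y; rewrite setUC.
- by move=> x y z /r_adj xy /r_adj xz; apply: prop_c.
- move=> x p p0 pr lx; apply/negP => up; apply: no_cycle.
  exact: rainbow_closed_walk_cycle r_adj r_alt x p p0 pr lx up.
Qed.

Lemma INR_le_log2 (m n : nat) :
  (2 ^ m <= n)%N -> Rle (INR m) (log2 (INR n)).
Proof.
move=> mn.
have two_gt0 : Rlt 0 (INR 2) by apply: lt_0_INR; lia.
have ln2_gt0 : Rlt 0 (ln (INR 2)).
  by rewrite -ln_1; apply: ln_increasing; [exact: Rlt_0_1 | apply: (lt_INR 1); lia].
apply: (Rmult_le_reg_r (ln (INR 2))) => //.
rewrite /log2 /Rdiv Rmult_assoc Rinv_l ?Rmult_1_r; last exact: Rgt_not_eq.
rewrite -ln_pow //.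
have pow_le : Rle (pow (INR 2) m) (INR n).
  by apply/RleP; rewrite RpowE !INRE -natrX ler_nat.
have pow_gt0 : Rlt 0 (pow (INR 2) m) by apply: pow_lt.
apply: Rnot_lt_le => lt_ln; apply: (Rle_not_lt _ _ pow_le).
by apply: ln_lt_inv => //; apply: Rlt_le_trans pow_le.
Qed.

Theorem theorem1p6 :
  exists C : R, exists N : nat, forall n : nat, (N <= n)%N ->
    forall (adj : rel 'I_n) (c : {set 'I_n} -> nat),
      simple_graph adj ->
      proper_colouring adj c ->
      Rle (Rmult (Rmult C (INR n)) (pow (log2 (INR n)) 4)) (INR #|edges adj|) ->
      exists s : seq 'I_n, rainbow_cycle adj c s /\ ~~ odd (size s).
Proof.
(* With [m] the integer part of the logarithm and [L = m + 1], the requirement is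
   [32 * (m + 1) ^ 2 + 4 < 200 * m ^ 4]. Taking [n >= 2] gives [m >= 1], whence [m + 1 <= 2 * m] and
   the left side is at most [132 * m ^ 2]. *)
exists (INR 200), 2%N => n n2 adj c simple_adj prop_c big.
pose m := trunc_log 2 n.
have m_gt0 : (0 < m)%N by rewrite trunc_log_gt0 n2.
have nm : (2 ^ m <= n < 2 ^ m.+1)%N by apply: trunc_log_bounds => //; apply: ltnW.
case/andP: nm => mn nm.
apply: (ex_rainbow_even_cycle_of_edges simple_adj prop_c nm).
have edges_ge : (200 * n * m ^ 4 <= #|edges adj|)%N.
  rewrite -(ler_nat R) natrM natrX natrM.
  have /RleP := INR_le_log2 mn; move: big => /RleP.
  rewrite !RmultE RpowE !INRE => big logm; apply: le_trans big.
  have log_ge0 := le_trans (ler0n R m) logm.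
  apply: ler_wpM2l; first by rewrite mulr_ge0 // ler0n.
  by apply: lerXn2r; rewrite ?nnegrE ?ler0n.
apply: leq_trans edges_ge.
have : (m ^ 2 <= m ^ 4)%N by rewrite leq_pexp2l.
have : (m.+1 ^ 2 <= m.*2 ^ 2)%N by rewrite leq_sqr; lia.
have : (0 < m ^ 2)%N by rewrite expn_gt0 m_gt0.
rewrite -(mul2n m) expnMn => m2_gt0 sq_le m2_le.
rewrite mulnAC ltn_pmul2r; last exact: leq_trans n2.
lia.
Qed.
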